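(* Let $n$ be a positive integer, and let $a,b,a_1,b_1$ be positive integers with $\gcd(a,b)=1$ and $\gcd(a_1,b_1)=1$. Then $$\begin{aligned}N_{(a,b)}^{4,8}(n)={}&8\sigma\big(\tfrac na\big)-32\sigma\big(\tfrac n{4a}\big)+16\sigma_3\big(\tfrac nb\big)-32\sigma_3\big(\tfrac n{2b}\big)+256\sigma_3\big(\tfrac n{4b}\big)+128W_{(a,b)}^{1,3}(n)-256W_{(a,2b)}^{1,3}(n)\\&+2048W_{(a,4b)}^{1,3}(n)-512W_{(4a,b)}^{1,3}(n)+1024W_{(2a,b)}^{1,3}\big(\tfrac n2\big)-8192W_{(a,b)}^{1,3}\big(\tfrac n4\big)\end{aligned}$$ and $$\begin{aligned}N_{(a_1,b_1)}^{8,4}(n)={}&8\sigma\big(\tfrac n{b_1}\big)-32\sigma\big(\tfrac n{4b_1}\big)+16\sigma_3\big(\tfrac n{a_1}\big)-32\sigma_3\big(\tfrac n{2a_1}\big)+256\sigma_3\big(\tfrac n{4a_1}\big)+128W_{(a_1,b_1)}^{3,1}(n)-512W_{(a_1,4b_1)}^{3,1}(n)\\&-256W_{(2a_1,b_1)}^{3,1}(n)+1024W_{(a_1,2b_1)}^{3,1}\big(\tfrac n2\big)+2048W_{(4a_1,b_1)}^{3,1}(n)-8192W_{(a_1,b_1)}^{3,1}\big(\tfrac n4\big).\end{aligned}$$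
   Context: For $k\ge 0$, $\sigma_k(n)=\sum_{0<d\mid n}d^k$ for positive integers $n$, and $\sigma_k(x)=0$ if $x$ is not a positive integer; $\sigma=\sigma_1$. For positive integers $\alpha,\beta$ and $(i,j)\in\{(1,3),(3,1)\}$, $W_{(\alpha,\beta)}^{i,j}(n)=\sum_{(k,l)\in\mathbb{N}^2,\ \alpha k+\beta l=n}\sigma_i(k)\sigma_j(l)$ with $\mathbb N=\{0,1,2,\dots\}$; $W_{(\alpha,\beta)}^{i,j}(x)=0$ if $x$ is not an integer. $N_{(a,b)}^{4,8}(n)$ is the number of $(x_1,\dots,x_{12})\in\mathbb{Z}^{12}$ with $n=a\sum_{i=1}^4x_i^2+b\sum_{i=5}^{12}x_i^2$, and $N_{(a_1,b_1)}^{8,4}(n)$ is the number of $(x_1,\dots,x_{12})\in\mathbb{Z}^{12}$ with $n=a_1\sum_{i=1}^{8}x_i^2+b_1\sum_{i=9}^{12}x_i^2$. *)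

(* Defs.v *)
From mathcomp Require Import all_boot all_order all_algebra.
From mathcomp Require Import finmap.
From mathcomp Require Import boolp classical_sets cardinality fsbigop.

Set Implicit Arguments.
Unset Strict Implicit.
Unset Printing Implicit Defensive.

Import Order.TTheory GRing.Theory Num.Theory.

Local Open Scope ring_scope.

(* The divisor sums and convolution sums take rational arguments, so that
   n / a, n / 2, etc. below are exact quotients. *)
Definition sigma (k : nat) (x : rat) : int :=
  if (0 < x) && (x \is a Num.nat) then
    \sum_(1 <= d < (Num.truncn x).+1 | (d %| Num.truncn x)%N) d%:Z ^+ k
  else 0.

(* For alpha, beta > 0 the index set is finite; it is empty when x is not a
   natural number, which gives the value 0 at such x. *)
Definition W (i j alpha beta : nat) (x : rat) : int :=
  \sum_(kl \in [set kl : nat * nat |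
                 alpha%:R * kl.1%:R + beta%:R * kl.2%:R = x]%classic)
     sigma i kl.1%:R * sigma j kl.2%:R.

(* fset_set sends an infinite set to the empty one; for a, b > 0 the set of
   representations is finite. *)
Definition Nrep (s t a b n : nat) : nat :=
  #|` fset_set [set x : {ffun 'I_(s + t) -> int} |
       n%:Z = a%:Z * (\sum_(i < s) x (lshift t i) ^+ 2)
            + b%:Z * (\sum_(i < t) x (rshift s i) ^+ 2)]%classic |.

(* Main.v *)
Require Import Defs.
From mathcomp Require Import all_boot all_order all_algebra finmap.
From mathcomp Require Import boolp classical_sets cardinality fsbigop zify ring.

Import Order.TTheory GRing.Theory Num.Theory.

Local Open Scope ring_scope.

(* Let theta be the theta series of the squares.  Then N^{4,8}_{(a,b)}(n) is
   the coefficient of q^n in theta(q^a)^4 theta(q^b)^8, so everything follows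
   from Jacobi's formulas for four and eight squares by expanding a product.

   Four squares: theta (theta^4)' = 4 theta' theta^4 is a recursion determining
   the coefficients f of theta^4, namely sum_i (n - 5 i^2) f(n - i^2) = 0.  That
   Jacobi's divisor sum satisfies it is a Liouville-type identity over the
   solutions of i^2 + d e = n: the weight (-1)^(i+d+e) (2i+d)(2i-e)(d+e) changes
   sign under one involution of {e > d + 2i} and another of {e < d + 2i}, so
   only the solutions with e = d + 2i contribute, and these have (i + d)^2 = n.

   Eight squares: theta^8 = (theta^4)^2 turns the formula into the evaluation
   of sum (-1)^(a+b+x+y) a b over a x + b y = n, which is done in the same way
   with involutions of {a < b} and {a > b}. *)

(** * Signs and sign-reversing involutions *)

Definition chi (z : int) : int := (-1) ^+ `|z|%N.

(** The explicit witness [k] reduces a comparison of signs to an identity that [ring] settles. *)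
Lemma chi_cong (x y k : int) : x = y + 2 * k -> chi x = chi y.
Proof.
move=> e; rewrite /chi -signr_odd -[in RHS]signr_odd; congr (_ ^+ nat_of_bool _).
by lia.
Qed.

Lemma chiD (x y : int) : chi (x + y) = chi x * chi y.
Proof.
rewrite /chi -exprD -signr_odd -[in RHS]signr_odd.
by congr (_ ^+ nat_of_bool _); lia.
Qed.

Lemma chiN (x : int) : chi (- x) = chi x.
Proof. by rewrite /chi abszN. Qed.

Lemma chi_sqr (x : int) : chi x * chi x = 1.
Proof. by rewrite -expr2 sqrr_sign. Qed.

Lemma chi_exp2 (x : int) : chi (x ^+ 2) = chi x.
Proof.
by rewrite /chi abszX -signr_odd oddX orFb signr_odd.
Qed.

Lemma chi_nat (n : nat) : chi n%:Z = (-1) ^+ n.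
Proof. by []. Qed.

Lemma big_reindex_involution (T : eqType) (s : seq T) (f : T -> T) (F : T -> int) : uniq s ->
  {in s, forall x, f x \in s} -> {in s, cancel f f} ->
  \sum_(x <- s) F x = \sum_(x <- s) F (f x).
Proof.
move=> us fs fK; rewrite -(big_map f xpredT F); apply: perm_big.
have umap : uniq [seq f x | x <- s].
  rewrite map_inj_in_uniq // => x y xs ys /(congr1 f).
  by rewrite !fK.
apply: uniq_perm => // y; apply/idP/mapP => [ys|[x xs ->]]; last exact: fs.
by exists (f y); rewrite ?fK ?fs.
Qed.

(** The sum equals its own negative. Fixed points of [f] are allowed: there [F x = - F x], so they
    contribute 0. *)
Lemma big_involution_eq0 (T : eqType) (s : seq T) (P : pred T) (f : T -> T)
    (F : T -> int) : uniq s ->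
  (forall x, x \in s -> P x ->
    [/\ f x \in s, P (f x), f (f x) = x & F (f x) = - F x]) ->
  \sum_(x <- s | P x) F x = 0.
Proof.
move=> us H; rewrite -big_filter; set t := [seq x <- s | P x].
have Ht x : x \in t -> [/\ f x \in t, f (f x) = x & F (f x) = - F x].
  rewrite !mem_filter => /andP[Px xs].
  by have [fs Pf -> ->] := H _ xs Px; rewrite Pf fs.
have : \sum_(x <- t) F x = - \sum_(x <- t) F x.
  rewrite {1}(@big_reindex_involution _ t f) ?filter_uniq //.
  - by rewrite -sumrN; apply: eq_big_seq => x /Ht[].
  - by move=> x /Ht[].
  - by move=> x /Ht[].
by move: (\sum_(x <- t) F x) => S; lia.
Qed.

Lemma big_seq_bij (T U : eqType) (s : seq T) (t : seq U) (h : U -> T) (F : T -> int) :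
  uniq s -> uniq t -> injective h ->
  (forall x, x \in s <-> exists2 u, u \in t & x = h u) ->
  \sum_(x <- s) F x = \sum_(u <- t) F (h u).
Proof.
move=> us ut hi H; rewrite -(big_map h xpredT F); apply: perm_big.
apply: uniq_perm => //; first by rewrite map_inj_uniq.
by move=> x; apply/idP/mapP => /H.
Qed.

(** * Finite lists of solutions *)

Definition zrange (N : nat) : seq int :=
  [seq j%:Z - N%:Z | j <- iota 0 (2 * N).+1].

Lemma mem_zrange N i : (i \in zrange N) = (`|i| <= N)%N.
Proof.
apply/mapP/idP => [[j]|iN]; first by rewrite mem_iota => jN ->; lia.
exists (absz (i + N%:Z)); first by rewrite mem_iota; lia.
by lia.
Qed.

Lemma zrange_uniq N : uniq (zrange N).
Proof. by rewrite map_inj_uniq ?iota_uniq // => i j /=; lia. Qed.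

(** Empty for [m <= 0], so the terms of a sum over i at [n - i ^+ 2] vanish by themselves once this
    argument is not positive. *)
Definition zdivs (m : int) : seq (int * int) :=
  if 0 < m then [seq (d%:Z, (`|m| %/ d)%N%:Z) | d <- divisors `|m|] else [::].

Lemma mem_zdivs m d e :
  ((d, e) \in zdivs m) = [&& 0 < d, 0 < e & d * e == m].
Proof.
rewrite /zdivs; case: ifPn => [m0|m0]; last first.
  by rewrite in_nil; apply/esym/negP => /and3P[d0 e0 /eqP de]; rewrite -de mulr_gt0 in m0.
have am0 : (0 < `|m|)%N by lia.
apply/mapP/and3P => [[k]|[d0 e0 /eqP de]].
  rewrite -dvdn_divisors // => km [-> ->].
  have k0 : (0 < k)%N by apply: dvdn_gt0 km.
  have mk : (k * (`|m| %/ k) = `|m|)%N by rewrite mulnC divnK.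
  have q0 : (0 < `|m| %/ k)%N by rewrite divn_gt0 // dvdn_leq.
  by split=> //; apply/eqP; rewrite -PoszM mk; lia.
have ade : (`|m| = `|d| * `|e|)%N by rewrite -de abszM.
exists `|d|%N; first by rewrite -dvdn_divisors // ade dvdn_mulr.
rewrite ade mulKn ?absz_gt0 ?gt_eqF //; congr (_, _); lia.
Qed.

Lemma zdivs_uniq m : uniq (zdivs m).
Proof.
rewrite /zdivs; case: ifP => // _.
by rewrite map_inj_uniq ?divisors_uniq // => d e [].
Qed.

Lemma mem_pairs_dep (A B : eqType) (s : seq A) (t : A -> seq B) a b :
  ((a, b) \in [seq (x, y) | x <- s, y <- t x]) = (a \in s) && (b \in t a).
Proof.
apply/allpairsPdep/andP => [[x [y [xs yt [-> ->]]]] //|[xs yt]].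
by exists a, b.
Qed.

Lemma pairs_dep_uniq (A B : eqType) (s : seq A) (t : A -> seq B) :
  uniq s -> (forall x, uniq (t x)) -> uniq [seq (x, y) | x <- s, y <- t x].
Proof.
move=> us ut; apply: allpairs_uniq_dep => // -[x y] [x' y'] _ _ /= [xx'].
by rewrite -{}xx' => ->.
Qed.

(** For [n <= N] these are all solutions of i^2 + d e = n with d, e > 0. Keeping [N] apart from [n]
    lets one range of i serve the whole recursion. *)
Definition sqdivs (N : nat) (n : int) : seq (int * (int * int)) :=
  [seq (i, p) | i <- zrange N, p <- zdivs (n - i ^+ 2)].

Lemma mem_sqdivs N n i d e : n <= N%:Z ->
  ((i, (d, e)) \in sqdivs N n) = [&& 0 < d, 0 < e & i ^+ 2 + d * e == n].
Proof.
move=> nN; rewrite mem_pairs_dep mem_zrange mem_zdivs.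
apply/and4P/and3P => [[_ d0 e0 /eqP de]|[d0 e0 /eqP de]].
  by split=> //; apply/eqP; lia.
by split=> //; [nia | apply/eqP; lia].
Qed.

Lemma sqdivs_uniq N n : uniq (sqdivs N n).
Proof. by apply: pairs_dep_uniq (zrange_uniq N) _ => i; exact: zdivs_uniq. Qed.

(* Quadruples with a x + b y = n; the redundant first component j = a x makes
   sums over [prodsums n] convolutions by construction. *)
Definition prodsums (n : nat) : seq (int * ((int * int) * (int * int))) :=
  [seq (j, pq) | j <- zrange n, pq <- [seq (p, q) | p <- zdivs j, q <- zdivs (n%:Z - j)]].

Lemma mem_prodsums n j a x b y :
  ((j, ((a, x), (b, y))) \in prodsums n) =
  [&& 0 < a, 0 < x, 0 < b, 0 < y, a * x == j & a * x + b * y == n%:Z].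
Proof.
rewrite !mem_pairs_dep mem_zrange !mem_zdivs.
apply/and3P/and5P.
  move=> [_ /and3P[a0 x0 /eqP ax] /and3P[b0 y0 /eqP by_]].
  by split=> //; apply/andP; split; apply/eqP; lia.
move=> [a0 x0 b0 y0 /andP[/eqP ax /eqP by_]].
split; [nia| |]; apply/and3P; split=> //; apply/eqP; lia.
Qed.

Lemma prodsums_uniq n : uniq (prodsums n).
Proof.
apply: pairs_dep_uniq (zrange_uniq n) _ => j.
by apply: pairs_dep_uniq (zdivs_uniq j) _ => p; exact: zdivs_uniq.
Qed.

(** * The recursion for four squares *)

(* The two involutions are the substitutions x -> x + y and y -> x + y in the
   quadratic form d x^2 + 2 i x y - e y^2 of discriminant 4 n, each composed
   with a reflection preserving the discriminant; the weight is odd under both. *)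
Lemma sqdivs_sum_boundary N n : n <= N%:Z ->
  \sum_(t <- sqdivs N n) chi (t.1 + t.2.1 + t.2.2) *
     ((2 * t.1 + t.2.1) * (2 * t.1 - t.2.2) * (t.2.1 + t.2.2)) =
  \sum_(t <- sqdivs N n | t.2.2 == t.2.1 + 2 * t.1) chi (t.1 + t.2.1 + t.2.2) *
     ((2 * t.1 + t.2.1) * (2 * t.1 - t.2.2) * (t.2.1 + t.2.2)).
Proof.
move=> nN; rewrite (bigID (fun t => t.2.2 == t.2.1 + 2 * t.1)) /=.
rewrite -[RHS]addr0; congr (_ + _).
rewrite (bigID (fun t => t.2.1 + 2 * t.1 < t.2.2)) /=.
rewrite (@big_involution_eq0 _ _ _ (fun t =>
  (- t.1 - t.2.1, (t.2.1, t.2.2 - 2 * t.1 - t.2.1)))) ?sqdivs_uniq //; last first.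
  move=> [i [d e]] /=; rewrite !mem_sqdivs // => /and3P[d0 e0 /eqP ide].
  move=> /andP[neq lt]; split.
  - by apply/and3P; split; [| lia | apply/eqP; rewrite -ide; ring].
  - by lia.
  - by congr (_, (_, _)); ring.
  - rewrite (@chi_cong _ (i + d + e) (- 2 * i - d)); last by ring.
    ring.
rewrite add0r.
apply: (@big_involution_eq0 _ _ _ (fun t =>
  (t.2.2 - t.1, (t.2.1 + 2 * t.1 - t.2.2, t.2.2)))); rewrite ?sqdivs_uniq //.
move=> [i [d e]] /=; rewrite !mem_sqdivs // => /and3P[d0 e0 /eqP ide].
move=> /andP[neq lt]; split.
- by apply/and3P; split; [lia | | apply/eqP; rewrite -ide; ring].
- by lia.
- by congr (_, (_, _)); ring.
- rewrite (@chi_cong _ (i + d + e) 0); last by ring.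
  ring.
Qed.

(** Both i -> -i and d <-> e preserve the solutions and the sign. Averaging over the first leaves
    -(d + e)(d e - 4 i^2), and the second replaces d + e by 2 d. On solutions d e - 4 i^2 = n - 5
    i^2, the factor in the recursion. *)
Lemma sqdivs_sum_symm N n : n <= N%:Z ->
  \sum_(t <- sqdivs N n) chi (t.1 + t.2.1 + t.2.2) *
     ((2 * t.1 + t.2.1) * (2 * t.1 - t.2.2) * (t.2.1 + t.2.2)) =
  - 2 * \sum_(t <- sqdivs N n) chi (t.1 + t.2.1 + t.2.2) *
     (t.2.1 * (t.2.1 * t.2.2 - 4 * t.1 ^+ 2)).
Proof.
move=> nN.
set X := \sum_(t <- _) _; set Y := \sum_(t <- _) _.
have X' : X = \sum_(t <- sqdivs N n) chi (t.1 + t.2.1 + t.2.2) *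
     ((- 2 * t.1 + t.2.1) * (- 2 * t.1 - t.2.2) * (t.2.1 + t.2.2)).
  rewrite /X (@big_reindex_involution _ _ (fun t => (- t.1, t.2))) ?sqdivs_uniq //=.
  - apply: eq_bigr => -[i [d e]] _ /=; congr (_ * _); last by ring.
    by apply: (@chi_cong _ _ (- i)); ring.
  - move=> [i [d e]] /=; rewrite !mem_sqdivs // => /and3P[-> -> /eqP <-] /=.
    by apply/eqP; ring.
  - by move=> [i de] _ /=; rewrite opprK.
have Y' : Y = \sum_(t <- sqdivs N n) chi (t.1 + t.2.1 + t.2.2) *
     (t.2.2 * (t.2.1 * t.2.2 - 4 * t.1 ^+ 2)).
  rewrite /Y (@big_reindex_involution _ _ (fun t => (t.1, (t.2.2, t.2.1)))) ?sqdivs_uniq //=.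
  - by apply: eq_bigr => -[i [d e]] _ /=; congr (chi _ * _); ring.
  - move=> [i [d e]] /=; rewrite !mem_sqdivs // => /and3P[-> -> /eqP <-] /=.
    by apply/eqP; ring.
  - by move=> [i [d e]].
have : X + X = - 2 * (Y + Y).
  rewrite {2}X' {2}Y' /X /Y -!big_split mulr_sumr; apply: eq_bigr => -[i [d e]] _ /=.
  ring.
by lia.
Qed.

Lemma alt_sum_parabola (s : nat) :
  \sum_(0 <= d < (2 * s).+1) (-1) ^+ d * (d%:Z * (2 * s%:Z - d%:Z)) = - s%:Z.
Proof.
(* The constant [c] is decoupled from the number of terms, so that induction on [m] only appends two
   terms. *)
suff H (m : nat) (c : int) : 
    2 * \sum_(0 <= d < (2 * m).+1) (-1) ^+ d * (d%:Z * (c - d%:Z)) =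
    2 * m%:Z * (c - 2 * m%:Z - 1).
  have two : (2 : int) != 0 by [].
  by apply: (mulfI two); rewrite H; ring.
elim: m => [|m IH]; first by rewrite muln0 big_nat1; ring.
have -> : ((2 * m.+1).+1 = (2 * m).+3)%N by lia.
rewrite big_nat_recr //= big_nat_recr //= !mulrDr IH.
have -> : (-1) ^+ (2 * m).+1 = -1 :> int by rewrite exprS exprM sqrrN expr1n mulr1.
have -> : (-1) ^+ (2 * m).+2 = 1 :> int by rewrite !exprS exprM sqrrN expr1n; ring.
rewrite !intS PoszM; ring.
Qed.

(** On the boundary i^2 + d e = (i + d)^2, so i = s - d and e = 2 s - d with 0 < d < 2 s, and the
    weight is -2 s (-1)^(s+d) d (2 s - d). *)
Lemma sqdivs_boundary_sqr N (s : nat) : (0 < s)%N -> (s ^ 2 <= N)%N ->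
  \sum_(t <- sqdivs N (s%:Z ^+ 2) | t.2.2 == t.2.1 + 2 * t.1)
     chi (t.1 + t.2.1 + t.2.2) *
     ((2 * t.1 + t.2.1) * (2 * t.1 - t.2.2) * (t.2.1 + t.2.2)) =
  2 * chi s%:Z * s%:Z ^+ 2.
Proof.
move=> s0 sN.
have nN : s%:Z ^+ 2 <= N%:Z by lia.
rewrite -big_filter.
rewrite (@big_seq_bij _ _ _ (index_iota 1 (2 * s)) (fun d : nat =>
  (s%:Z - d%:Z, (d%:Z, 2 * s%:Z - d%:Z)))).
- transitivity (\sum_(0 <= d < (2 * s).+1)
     - 2 * s%:Z * chi s%:Z * ((-1) ^+ d * (d%:Z * (2 * s%:Z - d%:Z)))).
    (* The terms d = 0 and d = 2 s, absent on the left, vanish. *)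
    rewrite [RHS]big_nat_recr //= [X in _ = X + _]big_ltn; last by lia.
    rewrite PoszM subrr mul0r !mulr0 addr0 add0r.
    apply: eq_big_nat => d _.
    rewrite -chi_nat (@chi_cong _ (s%:Z + d%:Z) (s%:Z - d%:Z)); last by ring.
    by rewrite chiD; ring.
  by rewrite -mulr_sumr alt_sum_parabola; ring.
- by rewrite filter_uniq ?sqdivs_uniq.
- by rewrite iota_uniq.
- by move=> d d' [] /=; lia.
- move=> [i [d e]]; rewrite mem_filter mem_sqdivs //=; split.
    move=> /and4P[/eqP ei d0 e0 /eqP ide].
    have /eqP : (i + d) ^+ 2 = s%:Z ^+ 2 by rewrite -ide ei; ring.
    (* The root i + d = -s is impossible, since 2 (i + d) = d + e > 0. *)
    rewrite eqf_sqr => /orP[/eqP ids|/eqP ids]; last by lia.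
    exists `|d|%N; first by rewrite mem_index_iota; lia.
    by congr (_, (_, _)); lia.
  move=> [k]; rewrite mem_index_iota => k0 [-> -> ->].
  apply/and4P; split; [apply/eqP; lia | lia | lia |].
  by apply/eqP; ring.
Qed.

Lemma sqdivs_boundary_nonsqr N n : n <= N%:Z -> (forall s : int, s ^+ 2 != n) ->
  \sum_(t <- sqdivs N n | t.2.2 == t.2.1 + 2 * t.1)
     chi (t.1 + t.2.1 + t.2.2) *
     ((2 * t.1 + t.2.1) * (2 * t.1 - t.2.2) * (t.2.1 + t.2.2)) = 0.
Proof.
move=> nN nsq; rewrite big_seq_cond big1 // => -[i [d e]] /=.
rewrite mem_sqdivs // => /andP[/and3P[d0 e0 /eqP ide] /eqP ei].
by case/eqP: (nsq (i + d)); rewrite -ide ei; ring.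
Qed.

(** The number of representations by four squares, in a signed form of Jacobi's formula that matches
    the Liouville weight; it is 0 for [m < 0]. *)
Definition jacobi4 (m : int) : int :=
  (m == 0)%:R - 8 * chi m * \sum_(p <- zdivs m) chi (p.1 + p.2) * p.1.

(** Since i^2 + d e = n, the divisor sums add up to -8 (-1)^n [Y], where [Y] is minus half the
    boundary sum. The value 1 at 0 contributes -4 n for each i with i^2 = n. If n = k^2, these are
    -8 k^2 and 8 k^2; otherwise both parts vanish. *)
Lemma jacobi4_rec (N n : nat) : (0 < n <= N)%N ->
  \sum_(i <- zrange N) (n%:Z - 5 * i ^+ 2) * jacobi4 (n%:Z - i ^+ 2) = 0.
Proof.
move=> /andP[n0 nN].
have nN' : n%:Z <= N%:Z by [].
have := sqdivs_sum_symm N n%:Z nN'; rewrite sqdivs_sum_boundary //.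
set A := \sum_(t <- _ | _) _; set Y := \sum_(t <- _) _ => AY.
have -> : \sum_(i <- zrange N) (n%:Z - 5 * i ^+ 2) * jacobi4 (n%:Z - i ^+ 2) =
    \sum_(i <- zrange N | i ^+ 2 == n%:Z) (- 4 * n%:Z) - 8 * chi n%:Z * Y.
  rewrite /Y big_allpairs_dep mulr_sumr [X in _ = X - _]big_mkcond -sumrB.
  apply: eq_bigr => i _ /=; rewrite /jacobi4 mulrBr; congr (_ - _).
    by rewrite subr_eq0 eq_sym; case: eqP => [<-|_] /=; rewrite ?mulr0 // mulr1; ring.
  rewrite !mulr_sumr; apply: eq_big_seq => -[d e]; rewrite mem_zdivs => /and3P[_ _ /eqP de] /=.
  rewrite !chiD chiN chi_exp2 -/(chi n%:Z).
  have -> : n%:Z = d * e + i ^+ 2 by rewrite de; ring.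
  by ring.
have [[s sn]|nosq] := pselect (exists s : int, s ^+ 2 = n%:Z).
  pose k := `|s|%N.
  have kn : n%:Z = k%:Z ^+ 2 by rewrite -sn /k; lia.
  have k0 : (0 < k)%N by lia.
  have Ak : A = 2 * chi k%:Z * k%:Z ^+ 2.
    by rewrite /A kn sqdivs_boundary_sqr //; lia.
  rewrite -big_filter (perm_big [:: k%:Z; - k%:Z]); last first.
    apply: uniq_perm; first by rewrite filter_uniq ?zrange_uniq.
      by rewrite /= inE; lia.
    move=> i; rewrite mem_filter mem_zrange !inE kn eqf_sqr.
    by case: eqP => [->|_]; case: eqP => [->|_] //=; nia.
  have -> : Y = - (chi k%:Z * k%:Z ^+ 2).
    have two : (2 : int) != 0 by [].
    by apply: (mulfI two); rewrite mulrN mulrA -Ak AY mulNr opprK.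
  rewrite kn chi_exp2 !big_cons big_nil /=.
  have -> : 8 * chi k%:Z * - (chi k%:Z * k%:Z ^+ 2) =
    - 8 * (chi k%:Z * chi k%:Z) * k%:Z ^+ 2 by ring.
  by rewrite chi_sqr; ring.
have A0 : A = 0.
  by apply: sqdivs_boundary_nonsqr => // s; apply/eqP => sn; apply: nosq; exists s.
have -> : Y = 0 by move: AY; rewrite A0; lia.
rewrite big1 ?mulr0 ?subr0 // => i /eqP ni; case: nosq; by exists i.
Qed.

(** The theta series cut off at |i| <= N; up to degree [N], its powers have the same coefficients as
    those of the full series. *)
Definition theta (N : nat) : {poly int} :=
  \sum_(i <- zrange N) 'X^(`|i| ^ 2)%N.

(** Extending coefficients by 0 to negative indices lets i run over all of [zrange N] in the
    recursion. *)
Definition zcoef (p : {poly int}) (m : int) : int :=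
  if m < 0 then 0 else p`_`|m|.

Lemma coef_XnM_zcoef (p : {poly int}) (i : int) (n : nat) :
  ('X^(`|i| ^ 2)%N * p)`_n = zcoef p (n%:Z - i ^+ 2).
Proof.
rewrite coefXnM /zcoef.
have -> : (n%:Z - i ^+ 2 < 0) = (n < `|i| ^ 2)%N by lia.
by case: ltnP => // h; congr (p`_ _); lia.
Qed.

Lemma coef_X_deriv (p : {poly int}) (n : nat) : ('X * p^`())`_n = p`_n * n%:Z.
Proof.
rewrite coefXM; case: n => [|n] /=; first by rewrite mulr0.
by rewrite coef_deriv -mulr_natr pmulrn intz.
Qed.

(** Compares coefficients in theta * X (theta^s)' = s * X theta' * theta^s, an identity of the
    truncated polynomials themselves; X d/dX multiplies a coefficient by its degree. *)
Lemma theta_rec (s N n : nat) :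
  \sum_(i <- zrange N) (n%:Z - s.+1%:Z * i ^+ 2) * zcoef (theta N ^+ s) (n%:Z - i ^+ 2) = 0.
Proof.
have e : theta N * ('X * (theta N ^+ s)^`()) =
    \sum_(i <- zrange N) (s%:Z * i ^+ 2) *: ('X^(`|i| ^ 2)%N * theta N ^+ s).
  have dT : 'X * (theta N)^`() = \sum_(i <- zrange N) (i ^+ 2) *: 'X^(`|i| ^ 2)%N.
    rewrite /theta raddf_sum mulr_sumr; apply: eq_bigr => i _ /=.
    apply/polyP => j; rewrite coef_X_deriv coefZ coefXn.
    by case: eqP => [->|_]; rewrite ?mulr1 ?mul1r ?mul0r ?mulr0; lia.
  transitivity (s%:Z *: (('X * (theta N)^`()) * theta N ^+ s)).
    case: s => [|s]; first by rewrite expr0 derivC !mulr0 scale0r.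
    by rewrite deriv_exp /= exprS -mulr_natl -mul_polyC pmulrn -rmorphMz /= intz; ring.
  rewrite dT mulr_suml scaler_sumr; apply: eq_bigr => i _.
  by rewrite -scalerAl scalerA.
have /(congr1 (fun p : {poly int} => p`_n)) := e.
rewrite {1}/theta mulr_suml !coef_sum => /eqP; rewrite -subr_eq0 -sumrB => /eqP e'.
rewrite -[RHS]e'; apply: eq_bigr => i _.
rewrite coefZ !coef_XnM_zcoef /zcoef; case: ifP => [|h]; first by rewrite !mulr0 subr0.
rewrite coef_X_deriv intS.
have -> : `|n%:Z - i ^+ 2|%N%:Z = n%:Z - i ^+ 2 by lia.
by ring.
Qed.

Lemma theta_coef0 N s : (theta N ^+ s)`_0 = 1.
Proof.
have -> : (theta N ^+ s)`_0 = (theta N)`_0 ^+ s.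
  by rewrite -!horner_coef0 hornerE.
suff -> : (theta N)`_0 = 1 by rewrite expr1n.
rewrite /theta coef_sum (bigD1_seq 0) ?zrange_uniq ?mem_zrange //= coefXn.
by rewrite big1 // => i i0; rewrite coefXn; case: eqP => //; nia.
Qed.

(** Both sides start with 1 and satisfy the same recursion. Its term i = 0 carries the factor n,
    nonzero for n > 0, and all other terms have index n - i^2 < n. *)
Lemma jacobi_four_squares N (n : nat) : (n <= N)%N ->
  (theta N ^+ 4)`_n = jacobi4 n%:Z.
Proof.
elim/ltn_ind: n => n IH nN.
have [->|n0] := posnP n.
  by rewrite theta_coef0 /jacobi4 /zdivs /= big_nil mulr0 subr0.
have ext (m : int) : m < n%:Z -> zcoef (theta N ^+ 4) m = jacobi4 m.
  rewrite /zcoef => mn; case: ifPn => [m0|m0].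
    rewrite /jacobi4 /zdivs lt_eqF //.
    have -> : (0 < m) = false by lia.
    by rewrite big_nil mulr0 subr0.
  rewrite -leNgt in m0.
  rewrite IH; [by congr jacobi4; lia | lia | lia].
have n1 : (0 < n <= N)%N by rewrite n0.
have := theta_rec 4 N n; rewrite -[RHS](jacobi4_rec N n n1) => /eqP.
rewrite -subr_eq0 -sumrB (bigD1_seq 0) ?zrange_uniq ?mem_zrange //=.
rewrite big1 ?addr0.
  rewrite -mulrBr mulf_eq0 subr_eq0 => /orP[|/eqP <-]; first lia.
  by rewrite /zcoef ltNge.
by move=> i i0; rewrite ext ?subrr //; nia.
Qed.

(** * The convolution for eight squares *)

(** The involution of {a < b} exchanges the first two terms up to sign and negates the third; that
    of {a > b} exchanges the first and third up to sign and negates the second. *)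
Definition prod_weight (t : int * ((int * int) * (int * int))) : int :=
  let: (_, ((a, x), (b, y))) := t in
  chi (a + b + x + y) * ((b - a) ^+ 2 - (x + y) ^+ 2)
  + chi (b + x) * (b ^+ 2 - x ^+ 2) + chi (a + y) * (a ^+ 2 - y ^+ 2).

(* Unimodular column operations on [[a, b], [-y, x]], which preserve the
   determinant a x + b y, composed with symmetries of that form. *)
Lemma prodsums_boundary n :
  \sum_(t <- prodsums n) prod_weight t =
  \sum_(t <- prodsums n | t.2.1.1 == t.2.2.1) prod_weight t.
Proof.
rewrite (bigID (fun t => t.2.1.1 == t.2.2.1)) /=.
rewrite -[RHS]addr0; congr (_ + _).
rewrite (bigID (fun t => t.2.1.1 < t.2.2.1)) /=.
rewrite (@big_involution_eq0 _ _ _ (fun t => let: (_, ((a, x), (b, y))) := t in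
  (y * (b - a), ((y, b - a), (x + y, a))))) ?prodsums_uniq //; last first.
  move=> [j [[a x] [b y]]] /=; rewrite !mem_prodsums.
  move=> /and5P[a0 x0 b0 y0 /andP[/eqP axj /eqP axby]] /andP[neq lt]; split.
  - apply/and5P; split; [lia|lia|lia|lia|apply/andP; split; apply/eqP].
      by ring.
    by rewrite -axby; ring.
  - by lia.
  - by rewrite -axj; congr (_, ((_, _), (_, _))); ring.
  - rewrite (@chi_cong (y + (x + y) + (b - a) + a) (b + x) y); last by ring.
    rewrite (@chi_cong (x + y + (b - a)) (a + b + x + y) (- a)); last by ring.
    rewrite (addrC y a); ring.
rewrite add0r.
apply: (@big_involution_eq0 _ _ _ (fun t => let: (_, ((a, x), (b, y))) := t in
  ((x + y) * b, ((x + y, b), (x, a - b))))); rewrite ?prodsums_uniq //.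
move=> [j [[a x] [b y]]] /=; rewrite !mem_prodsums.
move=> /and5P[a0 x0 b0 y0 /andP[/eqP axj /eqP axby]] /andP[neq lt]; split.
- apply/and5P; split; [lia|lia|lia|lia|apply/andP; split; apply/eqP].
    by ring.
  by rewrite -axby; ring.
- by lia.
- by rewrite -axj; congr (_, ((_, _), (_, _))); ring.
- rewrite (@chi_cong (x + y + x + b + (a - b)) (a + y) x); last by ring.
  rewrite (@chi_cong (x + y + (a - b)) (a + b + x + y) (- b)); last by ring.
  rewrite (addrC x b); ring.
Qed.

(** Exchanging (a, b) with (x, y) cancels the squares in the first term of the weight and turns x y
    into a b. The map (a, x, b, y) -> (y, b, x, a) negates each of the other two terms. *)
Lemma prodsums_symm n :
  \sum_(t <- prodsums n) prod_weight t =
  - 4 * \sum_(t <- prodsums n)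
    chi (t.2.1.1 + t.2.2.1 + t.2.1.2 + t.2.2.2) * (t.2.1.1 * t.2.2.1).
Proof.
set Y := \sum_(t <- prodsums n) chi _ * _.
have reindex (F : int * ((int * int) * (int * int)) -> int) f :
    (forall t, t \in prodsums n -> f t \in prodsums n /\ f (f t) = t) ->
    \sum_(t <- prodsums n) F t = \sum_(t <- prodsums n) F (f t).
  move=> H; apply: big_reindex_involution (prodsums_uniq n) _ _ => t /H[] //.
have Y' : Y = \sum_(t <- prodsums n)
    chi (t.2.1.1 + t.2.2.1 + t.2.1.2 + t.2.2.2) * (t.2.1.2 * t.2.2.2).
  rewrite /Y (reindex _ (fun t => (t.1, ((t.2.1.2, t.2.1.1), (t.2.2.2, t.2.2.1))))).
    by apply: eq_bigr => t _ /=; congr (chi _ * _); ring.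
  move=> [j [[a x] [b y]]] /=; rewrite !mem_prodsums [x * a]mulrC [y * b]mulrC.
  by move=> /and5P[-> -> -> -> ->].
have S2 : \sum_(t <- prodsums n) (t.2.1.1 ^+ 2 + t.2.2.1 ^+ 2) *
      chi (t.2.1.1 + t.2.2.1 + t.2.1.2 + t.2.2.2) =
    \sum_(t <- prodsums n) (t.2.1.2 ^+ 2 + t.2.2.2 ^+ 2) *
      chi (t.2.1.1 + t.2.2.1 + t.2.1.2 + t.2.2.2).
  rewrite (reindex _ (fun t => (t.1, ((t.2.1.2, t.2.1.1), (t.2.2.2, t.2.2.1))))).
    by apply: eq_bigr => t _ /=; congr (_ * chi _); ring.
  move=> [j [[a x] [b y]]] /=; rewrite !mem_prodsums [x * a]mulrC [y * b]mulrC.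
  by move=> /and5P[-> -> -> -> ->].
have S1 : \sum_(t <- prodsums n) chi (t.2.2.1 + t.2.1.2) * (t.2.2.1 ^+ 2 - t.2.1.2 ^+ 2) = 0.
  apply: (@big_involution_eq0 _ _ xpredT
    (fun t => (t.2.2.1 * t.2.2.2, ((t.2.2.2, t.2.2.1), (t.2.1.2, t.2.1.1))))).
    exact: prodsums_uniq.
  move=> [j [[a x] [b y]]] /=; rewrite !mem_prodsums.
  move=> /and5P[a0 x0 b0 y0 /andP[/eqP axj /eqP axby]] _; split=> //.
  - apply/and5P; split=> //; apply/andP; split; apply/eqP.
      by ring.
    by rewrite -axby; ring.
  - by rewrite -axj; congr (_, _); ring.
  - by rewrite (addrC x b); ring.
have S3 : \sum_(t <- prodsums n) chi (t.2.1.1 + t.2.2.2) * (t.2.1.1 ^+ 2 - t.2.2.2 ^+ 2) = 0.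
  apply: (@big_involution_eq0 _ _ xpredT
    (fun t => (t.2.2.1 * t.2.2.2, ((t.2.2.2, t.2.2.1), (t.2.1.2, t.2.1.1))))).
    exact: prodsums_uniq.
  move=> [j [[a x] [b y]]] /=; rewrite !mem_prodsums.
  move=> /and5P[a0 x0 b0 y0 /andP[/eqP axj /eqP axby]] _; split=> //.
  - apply/and5P; split=> //; apply/andP; split; apply/eqP.
      by ring.
    by rewrite -axby; ring.
  - by rewrite -axj; congr (_, _); ring.
  - by rewrite (addrC y a); ring.
(* The summands are the a b part, the x y part, and the vanishing sums [S2], [S1], [S3]. *)
transitivity (- 2 * Y - 2 * Y + 0 + 0 + 0); last by ring.
move/eqP: S2; rewrite -subr_eq0 => /eqP S2.
rewrite {2}Y' -[X in _ = _ + X]S1 -[X in _ = _ + X + _]S3.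
rewrite -[X in _ = _ + X + _ + _]S2 /Y.
rewrite !mulr_sumr -!sumrB -!big_split; apply: eq_bigr => -[j [[a x] [b y]]] _ /=.
ring.
Qed.

Lemma alt_sum_sqr (a : int) (m : nat) :
  2 * \sum_(1 <= x < m.+1) (-1) ^+ x * (a ^+ 2 - x%:Z ^+ 2) =
  (-1) ^+ m.+1 * (m.+1%:Z * m%:Z) - (1 + (-1) ^+ m.+1) * a ^+ 2.
Proof.
elim: m => [|m IH]; first by rewrite big_geq //; ring.
rewrite big_nat_recr //= mulrDr IH !exprS !intS; ring.
Qed.

(** With a = b and x + y = m the first term is constant in x. The other two are exchanged by x -> m
    - x, so together they give twice an alternating sum of squares. *)
Lemma prod_weight_diag (a : int) (m : nat) : (0 < m)%N ->
  \sum_(1 <= x < m) prod_weight (a * x%:Z, ((a, x%:Z), (a, m%:Z - x%:Z))) =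
  - (chi m%:Z * m%:Z ^+ 2 * (m%:Z - 1)) + chi (a + m%:Z) * (m%:Z * (m%:Z - 1))
  - (chi a + chi (a + m%:Z)) * a ^+ 2.
Proof.
case: m => // m _.
have rev : \sum_(1 <= x < m.+1) chi (a + (m.+1%:Z - x%:Z)) *
      (a ^+ 2 - (m.+1%:Z - x%:Z) ^+ 2) =
    \sum_(1 <= x < m.+1) chi (a + x%:Z) * (a ^+ 2 - x%:Z ^+ 2).
  rewrite [RHS]big_nat_rev /=; apply: eq_big_nat => x xm.
  by have -> : (1 + m.+1 - x.+1)%:Z = m.+1%:Z - x%:Z by lia.
transitivity (\sum_(1 <= x < m.+1) - (chi m.+1%:Z * m.+1%:Z ^+ 2) +
    chi a * (2 * \sum_(1 <= x < m.+1) (-1) ^+ x * (a ^+ 2 - x%:Z ^+ 2))).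
  have -> : chi a * (2 * \sum_(1 <= x < m.+1) (-1) ^+ x * (a ^+ 2 - x%:Z ^+ 2)) =
      \sum_(1 <= x < m.+1) chi (a + x%:Z) * (a ^+ 2 - x%:Z ^+ 2) +
      \sum_(1 <= x < m.+1) chi (a + x%:Z) * (a ^+ 2 - x%:Z ^+ 2).
    rewrite -big_split !mulr_sumr; apply: eq_bigr => x _ /=.
    by rewrite chiD chi_nat; ring.
  rewrite -{2}rev -!big_split; apply: eq_bigr => x _ /=.
  rewrite (@chi_cong (a + a + x%:Z + (m.+1%:Z - x%:Z)) m.+1%:Z a); last by ring.
  rewrite (_ : x%:Z + (m.+1%:Z - x%:Z) = m.+1%:Z); last by ring.
  by ring.
rewrite alt_sum_sqr sumr_const_nat subn1 /= chiD chi_nat -mulr_natr pmulrn !intS.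
rewrite intz; ring.
Qed.

Lemma zdivs_sum_swap m (F : int -> int -> int) :
  \sum_(p <- zdivs m) F p.1 p.2 = \sum_(p <- zdivs m) F p.2 p.1.
Proof.
rewrite (@big_reindex_involution _ _ (fun p => (p.2, p.1))) ?zdivs_uniq //.
  by move=> [d e]; rewrite !mem_zdivs mulrC => /and3P[-> -> ->].
by case.
Qed.

(** For a = b the equation reads a (x + y) = n: a factorisation n = a m together with a splitting m
    = x + y, 1 <= x < m. *)
Lemma prodsums_diag n :
  \sum_(t <- prodsums n | t.2.1.1 == t.2.2.1) prod_weight t =
  - \sum_(p <- zdivs n%:Z) (chi p.2 * p.2 ^+ 3 + chi (p.1 + p.2) * p.2).
Proof.
rewrite -big_filter.
rewrite (@big_seq_bij _ _ _
  [seq (p, x) | p <- zdivs n%:Z, x <- index_iota 1 `|p.2|]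
  (fun px : (int * int) * nat => (px.1.1 * px.2%:Z,
     ((px.1.1, px.2%:Z), (px.1.1, px.1.2 - px.2%:Z))))).
- rewrite big_allpairs_dep /=.
  transitivity (\sum_(p <- zdivs n%:Z)
      (- (chi p.2 * p.2 ^+ 2 * (p.2 - 1)) + chi (p.1 + p.2) * (p.2 * (p.2 - 1))
       - (chi p.1 + chi (p.1 + p.2)) * p.1 ^+ 2)).
    apply: eq_big_seq => -[a m]; rewrite mem_zdivs => /and3P[a0 m0 _] /=.
    have -> : m = `|m|%N by lia.
    by rewrite prod_weight_diag ?absz_nat //; lia.
  (* The quadratic terms form F(m, a) - F(a, m), which cancels when the two factors are
     exchanged. *)
  pose F (d e : int) := (chi d + chi (d + e)) * d ^+ 2.
  transitivity (\sum_(p <- zdivs n%:Z)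
      (- (chi p.2 * p.2 ^+ 3 + chi (p.1 + p.2) * p.2) + F p.2 p.1) -
      \sum_(p <- zdivs n%:Z) F p.1 p.2).
    rewrite -sumrB; apply: eq_bigr => p _.
    by rewrite /F (addrC p.2 p.1); ring.
  by rewrite big_split /= (zdivs_sum_swap _ F) addrK sumrN.
- by rewrite filter_uniq ?prodsums_uniq.
- by apply: pairs_dep_uniq (zdivs_uniq _) _ => p; exact: iota_uniq.
- by move=> [[a m] x] [[a' m'] x'] [_ -> -> _] /= /(addIr _) ->.
- move=> [j [[a x] [b y]]]; rewrite mem_filter mem_prodsums /=; split.
    move=> /and3P[/eqP <- a0 /and4P[x0 _ y0 /andP[/eqP axj /eqP axby]]].
    exists ((a, x + y), `|x|%N).
      rewrite mem_pairs_dep mem_zdivs mem_index_iota /=.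
      apply/andP; split; last by lia.
      by apply/and3P; split; [|lia|apply/eqP; rewrite -axby; ring].
    rewrite /=; have -> : `|x|%N%:Z = x by lia.
    by congr (_, (_, (_, _))); [rewrite axj | ring].
  move=> [[[d e] k]]; rewrite mem_pairs_dep mem_zdivs mem_index_iota /=.
  move=> /andP[/and3P[d0 e0 /eqP de] k0] [-> -> -> -> ->].
  apply/and5P; split; [by []|lia|lia|lia|].
  apply/and3P; split; [lia|by []|].
  by apply/eqP; rewrite -de; ring.
Qed.

Lemma prodsums_sum n :
  4 * \sum_(t <- prodsums n)
    chi (t.2.1.1 + t.2.2.1 + t.2.1.2 + t.2.2.2) * (t.2.1.1 * t.2.2.1) =
  \sum_(p <- zdivs n%:Z) (chi p.1 * p.1 ^+ 3 + chi (p.1 + p.2) * p.1).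
Proof.
have := prodsums_diag n; rewrite -prodsums_boundary prodsums_symm.
rewrite mulNr => /oppr_inj ->.
rewrite -(zdivs_sum_swap _ (fun d e => chi d * d ^+ 3 + chi (e + d) * d)).
by apply: eq_bigr => p _; rewrite (addrC p.2).
Qed.

(** Jacobi's eight-square formula 16 sum (-1)^(m+d) d^3, with value 1 at 0. *)
Definition jacobi8 (m : int) : int :=
  (m == 0)%:R + 16 * chi m * \sum_(p <- zdivs m) chi p.1 * p.1 ^+ 3.

Lemma big_zrange_nonneg (n : nat) (F : int -> int) : (forall j, j < 0 -> F j = 0) ->
  \sum_(j <- zrange n) F j = \sum_(0 <= j < n.+1) F j%:Z.
Proof.
move=> F0; rewrite (bigID (fun j => j < 0)) /= big1 ?add0r => [|j /F0 //].
rewrite -big_filter (@big_seq_bij _ _ _ (index_iota 0 n.+1) Posz) //.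
- by rewrite filter_uniq ?zrange_uniq.
- exact: iota_uniq.
- by move=> ? ? [].
- move=> j; rewrite mem_filter mem_zrange; split=> [jn|[k]].
    by exists `|j|%N; rewrite ?mem_index_iota; lia.
  by rewrite mem_index_iota => ? ->; lia.
Qed.

(** The constant terms produce two cross terms -8 (-1)^n B(n). The convolution of B with itself,
    evaluated by [prodsums_sum], contributes 16 (-1)^n B(n), which cancels them, and the cubic
    divisor sum that remains. *)
Lemma jacobi4_square (n : nat) : (0 < n)%N ->
  \sum_(0 <= j < n.+1) jacobi4 j%:Z * jacobi4 (n%:Z - j%:Z) = jacobi8 n%:Z.
Proof.
move=> n0; pose B m := \sum_(p <- zdivs m) chi (p.1 + p.2) * p.1.
have -> : jacobi8 n%:Z =
    - 8 * chi n%:Z * B n%:Z + - 8 * chi n%:Z * B n%:Z +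
    64 * chi n%:Z * \sum_(0 <= j < n.+1) B j%:Z * B (n%:Z - j%:Z).
  have -> : \sum_(0 <= j < n.+1) B j%:Z * B (n%:Z - j%:Z) =
      \sum_(t <- prodsums n)
        chi (t.2.1.1 + t.2.2.1 + t.2.1.2 + t.2.2.2) * (t.2.1.1 * t.2.2.1).
    rewrite big_allpairs_dep -(@big_zrange_nonneg n (fun j => B j * B (n%:Z - j))).
      apply: eq_bigr => j _; rewrite big_allpairs_dep /= /B mulr_suml.
      apply: eq_bigr => -[a x] _; rewrite mulr_sumr.
      by apply: eq_bigr => -[b y] _ /=; rewrite !chiD; ring.
    move=> j j0; rewrite /B /zdivs ltNge ltW //= big_nil mul0r.
    by [].
  have -> : forall S c : int, 64 * c * S = 16 * c * (4 * S) by move=> S c; ring.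
  rewrite prodsums_sum big_split /= -/(B n%:Z) /jacobi8 gt_eqF //=.
  by rewrite mulr0n add0r; ring.
have B0 : B 0 = 0 by rewrite /B big_nil.
transitivity (\sum_(0 <= j < n.+1) (- 8 * chi n%:Z * B n%:Z * (j == 0)%N%:R
    + (- 8 * chi n%:Z * B n%:Z * (j == n)%:R
       + 64 * chi n%:Z * (B j%:Z * B (n%:Z - j%:Z))))).
  apply: eq_big_nat => j jn; rewrite /jacobi4 -!/(B _) subr_eq0 !eqz_nat (eq_sym n j).
  have [->|j0] := eqVneq j 0%N.
    rewrite eq_sym (gtn_eqF n0) subr0 /= mulr0n mulr1n B0; ring.
  have [->|jn'] := eqVneq j n.
    rewrite subrr mulr0n mulr1n B0; ring.
  rewrite (_ : chi n%:Z = chi j%:Z * chi (n%:Z - j%:Z)); first by rewrite mulr0n; ring.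
  by rewrite -chiD; congr chi; ring.
(* The indicator sums pick out j = 0 and j = n, the two cross terms. *)
rewrite !big_split /= -!mulr_sumr addrA; congr (_ + _).
by rewrite big_nat_recl //= [X in _ + _ * X = _]big_nat_recr //= !big1_seq ?addr0 ?add0r ?eqxx
  ?mulr1 // => j; rewrite mem_index_iota ?eqn0Ngt //= => jn; case: eqP => // ?; lia.
Qed.

Lemma jacobi_eight_squares N (n : nat) : (n <= N)%N ->
  (theta N ^+ 8)`_n = jacobi8 n%:Z.
Proof.
move=> nN; have [->|n0] := posnP n.
  by rewrite theta_coef0 /jacobi8 /zdivs /= big_nil mulr0 addr0.
rewrite (_ : 8 = 4 + 4)%N // exprD coefM -jacobi4_square // big_mkord.
apply: eq_bigr => -[j /= jn] _; rewrite !jacobi_four_squares; [|lia|lia].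
by congr (_ * jacobi4 _); lia.
Qed.

(** * Divisor sums, convolutions and representation numbers *)

(** The coefficients after the substitution q -> q^c, matching the convention that sigma vanishes at
    non-integers. *)
Definition dilate (c : nat) (u : nat -> int) (m : nat) : int :=
  if (c %| m)%N then u (m %/ c)%N else 0.

Definition sigma_nat (k m : nat) : int := \sum_(p <- zdivs m%:Z) p.1 ^+ k.

(** Dividing d by c and e by c' leaves a factorisation of m / (c c'). Conditions on both factors are
    allowed because the signs depend on both parities. *)
Lemma zdivs_sum_multiples (k c c' m : nat) : (0 < c)%N -> (0 < c')%N ->
  \sum_(p <- zdivs m%:Z | (c%:Z %| p.1)%Z && (c'%:Z %| p.2)%Z) p.1 ^+ k =
  c%:Z ^+ k * dilate (c * c') (sigma_nat k) m.
Proof.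
move=> c0 c'0; rewrite /dilate; case: ifPn => [/dvdnP[q ->]|ndvd].
  rewrite mulnK ?muln_gt0 ?c0 // /sigma_nat -big_filter.
  rewrite (@big_seq_bij _ _ _ (zdivs q%:Z) (fun p => (c%:Z * p.1, c'%:Z * p.2))).
  - by rewrite mulr_sumr; apply: eq_bigr => p _ /=; rewrite exprMn.
  - by rewrite filter_uniq ?zdivs_uniq.
  - exact: zdivs_uniq.
  - move=> [d e] [d' e'] /= [] /mulfI -> => [/mulfI ->//|]; lia.
  - move=> [d e]; rewrite mem_filter mem_zdivs /=; split.
      move=> /andP[/andP[/dvdzP[d' ->] /dvdzP[e' ->]] /and3P[d0 e0 /eqP de]].
      exists (d', e'); last by rewrite /= mulrC [e' * _]mulrC.
      rewrite mem_zdivs; apply/and3P; split.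
      + by rewrite pmulr_lgt0 in d0.
      + by rewrite pmulr_lgt0 in e0.
      + apply/eqP; have cc0 : (c%:Z * c'%:Z) != 0 by nia.
        apply: (mulIf cc0); transitivity (d' * c%:Z * (e' * c'%:Z)); first by ring.
        by rewrite de !PoszM; ring.
    move=> [[d' e']]; rewrite mem_zdivs => /and3P[d0 e0 /eqP de] /= [-> ->].
    rewrite !dvdz_mulr //=; apply/and3P; split; [by rewrite mulr_gt0|by rewrite mulr_gt0|].
    by apply/eqP; rewrite !PoszM -de; ring.
rewrite mulr0 big_seq_cond big1 // => -[d e] /=; rewrite mem_zdivs.
move=> /and3P[/and3P[d0 e0 /eqP de] /dvdzP[d' dE] /dvdzP[e' eE]].
case/negP: ndvd; apply/dvdnP; exists (absz (d' * e')).
have : m%:Z = d' * e' * (c * c')%N%:Z by rewrite -de dE eE PoszM; ring.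
by move=> /(congr1 absz); rewrite abszM !absz_nat.
Qed.

Lemma chi_parity (z : int) : chi z = 1 - 2 * (~~ (2 %| z)%Z)%:R.
Proof.
rewrite /chi -signr_odd.
have -> : odd `|z| = ~~ (2 %| z)%Z by lia.
by case: (2 %| z)%Z.
Qed.

(** The sign (-1)^(d e + d + e) is 1 if d and e are both even and -1 otherwise. *)
Lemma jacobi4_sigma (m : nat) :
  jacobi4 m%:Z = (m == 0)%N%:R + 8 * sigma_nat 1 m - 32 * dilate 4 (sigma_nat 1) m.
Proof.
have e := zdivs_sum_multiples 1 2 2 m isT isT.
have -> : 32 * dilate 4 (sigma_nat 1) m =
    16 * (2%:Z ^+ 1 * dilate (2 * 2) (sigma_nat 1) m) by rewrite expr1; ring.
rewrite -e /jacobi4 /sigma_nat -addrA; congr (_ + _).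
rewrite [X in _ = _ - _ * X]big_mkcond !mulr_sumr -sumrB -sumrN; apply: eq_big_seq => -[d e'].
rewrite mem_zdivs => /and3P[_ _ /eqP <-] /=.
rewrite chiD (chi_parity (d * e')) (chi_parity d) (chi_parity e').
have -> : (2 %| d * e')%Z = (2 %| d)%Z || (2 %| e')%Z by rewrite !dvdzE abszM Euclid_dvdM.
by case: (2 %| d)%Z; case: (2 %| e')%Z => /=; ring.
Qed.

(** The sign (-1)^(d e + d) is -1 exactly when e is even and d is odd, that is 1 - 2 [2 | e] + 2
    [2 | d and 2 | e]. *)
Lemma jacobi8_sigma (m : nat) :
  jacobi8 m%:Z = (m == 0)%N%:R + 16 * sigma_nat 3 m - 32 * dilate 2 (sigma_nat 3) m
    + 256 * dilate 4 (sigma_nat 3) m.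
Proof.
have e := zdivs_sum_multiples 3 2 2 m isT isT.
have e1 := zdivs_sum_multiples 3 1 2 m isT isT.
have -> : 256 * dilate 4 (sigma_nat 3) m =
    32 * (2%:Z ^+ 3 * dilate (2 * 2) (sigma_nat 3) m) by ring.
have -> : dilate 2 (sigma_nat 3) m = 1%:Z ^+ 3 * dilate (1 * 2) (sigma_nat 3) m by ring.
rewrite -e -e1 /jacobi8 /sigma_nat -!addrA; congr (_ + _).
rewrite [X in _ = _ + (- (_ * X) + _)]big_mkcond [X in _ = _ + (_ + _ * X)]big_mkcond.
rewrite !mulr_sumr -sumrN -!big_split; apply: eq_big_seq => -[d e'].
rewrite mem_zdivs => /and3P[_ _ /eqP <-] /=.
rewrite (chi_parity (d * e')) (chi_parity d) dvd1z.
have -> : (2 %| d * e')%Z = (2 %| d)%Z || (2 %| e')%Z by rewrite !dvdzE abszM Euclid_dvdM.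
by case: (2 %| d)%Z; case: (2 %| e')%Z => /=; ring.
Qed.

Lemma sigma_natr k (m : nat) : sigma k m%:R = sigma_nat k m.
Proof.
rewrite /sigma natr_nat natrK ltr0n andbT.
rewrite /sigma_nat /zdivs ltz_nat; case: ifPn => //= m0; last by rewrite big_nil.
rewrite big_map -big_filter; apply: perm_big; apply: uniq_perm.
- by rewrite filter_uniq ?iota_uniq.
- exact: divisors_uniq.
- move=> d; rewrite mem_filter mem_index_iota -dvdn_divisors //.
  by case: (boolP (d %| m)%N) => //= dm; rewrite (dvdn_gt0 m0 dm) ltnS dvdn_leq.
Qed.

Lemma sigma_div k (n c : nat) : (0 < c)%N ->
  sigma k (n%:R / c%:R) = dilate c (sigma_nat k) n.
Proof.
move=> c0; have c0' : c%:R != 0 :> rat by rewrite pnatr_eq0 -lt0n.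
rewrite /dilate; case: ifPn => [/dvdnP[q ->]|ndvd].
  by rewrite natrM mulfK // mulnK // sigma_natr.
rewrite /sigma; case: ifP => // /andP[_ /natrP[q qE]].
case/negP: ndvd; apply/dvdnP; exists q; apply/eqP; rewrite -(eqr_nat rat) natrM -qE.
by rewrite divfK.
Qed.

Definition conv (u v : nat -> int) (n : nat) : int :=
  \sum_(j < n.+1) u j * v (n - j)%N.

Lemma convC u v n : conv u v n = conv v u n.
Proof.
rewrite /conv (reindex_inj rev_ord_inj) /=; apply: eq_bigr => j _.
by rewrite subSS mulrC subKn // -ltnS.
Qed.

Lemma dilate_dilate c c' u n : (0 < c)%N -> (0 < c')%N ->
  dilate c (dilate c' u) n = dilate (c' * c) u n.
Proof.
move=> c0 c'0; rewrite /dilate; case: ifPn => [/dvdnP[q ->]|ndvd].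
  by rewrite mulnK // dvdn_pmul2r // divnMr.
by case: ifPn => // /(dvdn_trans (dvdn_mull _ (dvdnn c))) h; rewrite h in ndvd.
Qed.

(** Each factor is the unit at 0 plus a remainder, [U] or [V]. As n > 0, the product of the units
    contributes nothing, leaving U(n) + V(n) and the convolution of [U] and [V]. *)
Lemma conv_expand (A B C D E : nat -> int) n : (0 < n)%N ->
  conv (fun j => (j == 0)%N%:R + 8 * A j - 32 * B j)
      (fun j => (j == 0)%N%:R + 16 * C j - 32 * D j + 256 * E j) n =
  8 * A n - 32 * B n + 16 * C n - 32 * D n + 256 * E n
  + 128 * conv A C n - 256 * conv A D n + 2048 * conv A E n
  - 512 * conv B C n + 1024 * conv B D n - 8192 * conv B E n.
Proof.
move=> n0.
have dl (V : nat -> int) : \sum_(j < n.+1) (j == 0 :> nat)%:R * V (n - j)%N = V n.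
  rewrite big_ord_recl /= mul1r subn0 big1 ?addr0 // => j _.
  by rewrite mul0r.
have dr (V : nat -> int) : \sum_(j < n.+1) V j * (n - j == 0)%N%:R = V n.
  rewrite big_ord_recr /= subnn mulr1 big1 ?add0r // => j _.
  by rewrite subn_eq0 leqNgt ltn_ord mulr0.
pose V j := 16 * C j - 32 * D j + 256 * E j.
pose U j := 8 * A j - 32 * B j.
have convU v : conv U v n = 8 * conv A v n - 32 * conv B v n.
  by rewrite /conv !mulr_sumr -sumrB; apply: eq_bigr => j _; rewrite /U; ring.
have convV u : conv u V n = 16 * conv u C n - 32 * conv u D n + 256 * conv u E n.
  rewrite /conv !mulr_sumr -sumrB -big_split /=.
  by apply: eq_bigr => j _; rewrite /V; ring.
transitivity (U n + V n + conv U V n); last by rewrite convU !convV /U /V; ring.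
rewrite -(dr U) -(dl V) /conv -!big_split /=; apply: eq_bigr => j _.
have [->|j0] := eqVneq (nat_of_ord j) 0%N.
  by rewrite subn0 gtn_eqF // mulr0n mulr1n /U /V; ring.
by rewrite mulr0n /U /V; ring.
Qed.

(** * Representation numbers as coefficients of theta products *)

Lemma coef_comp_Xn_mul (p q : {poly int}) (a b n : nat) : (0 < a)%N -> (0 < b)%N ->
  ((p \Po 'X^a) * (q \Po 'X^b))`_n =
  conv (dilate a (fun j => p`_j)) (dilate b (fun j => q`_j)) n.
Proof.
move=> a0 b0; rewrite coefM; apply: eq_bigr => j _.
by rewrite !coef_comp_poly_Xn.
Qed.

Lemma theta_ord N : theta N = \sum_(j < (2 * N).+1) 'X^(`|j%:Z - N%:Z| ^ 2)%N.
Proof. by rewrite /theta big_map -[X in iota _ X]subn0 -/(index_iota 0 _) big_mkord. Qed.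

(** As a, b > 0, every solution has coordinates of absolute value at most n, so solutions can be
    counted in a finite box, whose points index the monomials of the expanded product. *)
Lemma Nrep_coef s t a b n : (0 < a)%N -> (0 < b)%N ->
  (Nrep s t a b n)%:Z =
  ((theta n ^+ s \Po 'X^a) * (theta n ^+ t \Po 'X^b))`_n.
Proof.
move=> a0 b0; set M := (2 * n).+1.
pose g (j : 'I_M) : int := j%:Z - n%:Z.
pose h (f : {ffun 'I_(s + t) -> 'I_M}) : {ffun 'I_(s + t) -> int} := [ffun i => g (f i)].
pose Q (x : {ffun 'I_(s + t) -> int}) :=
  n%:Z == a%:Z * (\sum_(i < s) x (lshift t i) ^+ 2)
            + b%:Z * (\sum_(i < t) x (rshift s i) ^+ 2).
have g_inj : injective g by move=> i j; rewrite /g => e; apply: val_inj => /=; lia.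
have h_inj : injective h.
  move=> f f' /ffunP e; apply/ffunP => i.
  by have := e i; rewrite !ffunE => /g_inj.
have sq_sum_ge (r : nat) (y : 'I_r -> int) i : y i ^+ 2 <= \sum_(k < r) y k ^+ 2.
  by rewrite (bigD1 i) //= lerDl sumr_ge0 // => k _; exact: sqr_ge0.
have bound x i : Q x -> (`|x i| <= n)%N.
  move=> /eqP Qx.
  have S1 : 0 <= \sum_(i < s) x (lshift t i) ^+ 2.
    by apply: sumr_ge0 => k _; exact: sqr_ge0.
  have S2 : 0 <= \sum_(i < t) x (rshift s i) ^+ 2.
    by apply: sumr_ge0 => k _; exact: sqr_ge0.
  suff : x i ^+ 2 <= n%:Z by nia.
  case: (split_ordP i) => k ->.
    by have := @sq_sum_ge s (fun k => x (lshift t k)) k; nia.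
  by have := @sq_sum_ge t (fun k => x (rshift s k)) k; nia.
have -> : Nrep s t a b n = #|[pred f | Q (h f)]|.
  rewrite /Nrep -/Q.
  pose l := [seq h f | f <- enum [pred f | Q (h f)]].
  (* Listing the solutions proves the set finite, so [fset_set] does not take its default value. *)
  have -> : [set x : {ffun 'I_(s + t) -> int} |
       n%:Z = a%:Z * (\sum_(i < s) x (lshift t i) ^+ 2)
            + b%:Z * (\sum_(i < t) x (rshift s i) ^+ 2)]%classic = [set` l]%classic.
    apply/seteqP; split=> x /=.
      move=> /eqP; rewrite -/(Q x) => Qx; apply/mapP.
      have lt i : (`|(x i + n%:Z)%R| < M)%N by have := bound x i Qx; rewrite /M; lia.
      have hx : h [ffun i => Ordinal (lt i)] = x.
        apply/ffunP => i; rewrite !ffunE /g /=.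
        by have := bound x i Qx; lia.
      by exists [ffun i => Ordinal (lt i)] => //; rewrite mem_enum inE hx.
    by move=> /mapP[f]; rewrite mem_enum inE => /eqP Qf ->.
  have -> : fset_set [set` l]%classic = [fset x | x in l]%fset.
    by apply/fsetP => x; rewrite in_fset_set ?inE //= mem_setE.
  rewrite card_fseq undup_id ?size_map -?cardE //.
  by rewrite map_inj_uniq ?enum_uniq.
pose w (i : 'I_(s + t)) := if (i < s)%N then a else b.
have comp (r c : nat) : (theta n ^+ r \Po 'X^c) =
    \prod_(i < r) \sum_(j < M) 'X^(c * `|g j| ^ 2)%N.
  rewrite rmorphXn /= theta_ord prodr_const card_ord; congr (_ ^+ r).
  rewrite raddf_sum; apply: eq_bigr => j _ /=.
  by rewrite comp_Xn_poly -exprM.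
rewrite !comp.
have -> : (\prod_(i < s) \sum_(j < M) 'X^(a * `|g j| ^ 2)%N) *
    (\prod_(i < t) \sum_(j < M) 'X^(b * `|g j| ^ 2)%N) =
    \prod_(i < s + t) \sum_(j < M) 'X^(w i * `|g j| ^ 2)%N :> {poly int}.
  rewrite big_split_ord; congr (_ * _); apply: eq_bigr => i _; rewrite /w /=.
    by rewrite ltn_ord.
  by rewrite ltnNge leq_addr.
(* The expanded product has one monomial for each choice [f] of all coordinates. *)
rewrite bigA_distr_bigA /= coef_sum -sum1_card big_mkcond /= -natz natr_sum.
apply: eq_bigr => f _; rewrite prodrXr coefXn inE.
have -> : Q (h f) = (n == \sum_(i < s + t) w i * `|g (f i)| ^ 2)%N.
  rewrite /Q -eqz_nat; congr (_ == _).
  rewrite -[RHS]natz natr_sum big_split_ord /= !mulr_sumr; congr (_ + _); apply: eq_bigr => i _.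
    by rewrite /w /= ltn_ord ffunE natz PoszM; congr (_ * _); lia.
  by rewrite /w /= ltnNge leq_addr ffunE natz PoszM; congr (_ * _); lia.
by case: eqP.
Qed.

(** Clears the fractional arguments: the sum for (2a, b) at n/2 becomes that for (4a, 2b) at n. *)
Lemma W_scale i j c alpha beta (x : rat) : (0 < c)%N ->
  W i j alpha beta (x / c%:R) = W i j (c * alpha) (c * beta) x.
Proof.
move=> c0; have c0' : c%:R != 0 :> rat by rewrite pnatr_eq0 -lt0n.
rewrite /W; congr (\big[_/_]_(_ \in _) _); apply/seteqP; split=> kl /=.
  by rewrite !natrM -!mulrA -mulrDr => ->; rewrite mulrCA divff // mulr1.
by rewrite !natrM -!mulrA -mulrDr => <-; rewrite [c%:R * _]mulrC mulfK.
Qed.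

(** The pairs (k, l) correspond to the indices alpha k of the Cauchy product; all other indices
    contribute 0 through [dilate]. *)
Lemma W_conv i j alpha beta n : (0 < alpha)%N -> (0 < beta)%N ->
  W i j alpha beta n%:R = conv (dilate alpha (sigma_nat i)) (dilate beta (sigma_nat j)) n.
Proof.
move=> a0 b0; rewrite /W.
pose l := [seq ((k %/ alpha)%N, ((n - k) %/ beta)%N) |
  k <- [seq k <- iota 0 n.+1 | (alpha %| k)%N && (beta %| n - k)%N]].
have ul : uniq l.
  rewrite map_inj_in_uniq ?filter_uniq ?iota_uniq // => k k'.
  rewrite !mem_filter => /andP[/andP[ak _] _] /andP[/andP[ak' _] _] [e _].
  by rewrite -(divnK ak) e divnK.
have -> : [set kl : nat * nat | alpha%:R * kl.1%:R + beta%:R * kl.2%:R = n%:R :> rat]%classic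
    = [set` l]%classic.
  apply/seteqP; split=> -[k k'] /=.
    rewrite -!natrM -natrD => /eqP; rewrite eqr_nat => /eqP e.
    apply/mapP; exists (alpha * k)%N.
      rewrite mem_filter mem_iota dvdn_mulr //= -e addKn dvdn_mulr //=.
      by rewrite add0n ltnS leq_addr.
    by rewrite -e addKn !mulKn.
  move=> /mapP[m]; rewrite mem_filter mem_iota => /andP[/andP[am bm] /= mn] [-> ->].
  by rewrite -!natrM -natrD mulnC divnK // mulnC divnK // subnKC.
rewrite -fsbig_seq // big_map big_filter big_mkcond /conv.
rewrite -[X in iota _ X]subn0 -/(index_iota 0 _) big_mkord; apply: eq_bigr => k _.
rewrite /dilate !sigma_natr; case: ifP => [/andP[-> ->] //|].
by case: (alpha %| k)%N; case: (beta %| _)%N => //=; rewrite ?mul0r ?mulr0.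
Qed.

(** * The coefficients of theta(q^a)^4 theta(q^b)^8 *)

Lemma dilate_theta4 n a j : (0 < a)%N -> (j <= n)%N ->
  dilate a (fun k => (theta n ^+ 4)`_k) j =
  (j == 0)%N%:R + 8 * dilate a (sigma_nat 1) j - 32 * dilate (4 * a) (sigma_nat 1) j.
Proof.
move=> a0 jn; rewrite -dilate_dilate // /dilate; case: ifPn => [aj|naj].
  rewrite jacobi_four_squares ?(leq_trans (leq_div _ _)) // jacobi4_sigma.
  by case/dvdnP: aj => q ->; rewrite mulnK // muln_eq0 (gtn_eqF a0) orbF.
by case: eqP naj => [->|_ _]; rewrite ?dvdn0 // !mulr0 subr0 addr0.
Qed.

Lemma dilate_theta8 n b j : (0 < b)%N -> (j <= n)%N ->
  dilate b (fun k => (theta n ^+ 8)`_k) j =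
  (j == 0)%N%:R + 16 * dilate b (sigma_nat 3) j - 32 * dilate (2 * b) (sigma_nat 3) j
  + 256 * dilate (4 * b) (sigma_nat 3) j.
Proof.
move=> b0 jn; rewrite -!dilate_dilate // /dilate; case: ifPn => [bj|nbj].
  rewrite jacobi_eight_squares ?(leq_trans (leq_div _ _)) // jacobi8_sigma.
  by case/dvdnP: bj => q ->; rewrite mulnK // muln_eq0 (gtn_eqF b0) orbF.
by case: eqP nbj => [->|_ _]; rewrite ?dvdn0 // !mulr0 subr0 !addr0.
Qed.

Lemma coef_theta4_theta8 (n a b : nat) : (0 < n)%N -> (0 < a)%N -> (0 < b)%N ->
  ((theta n ^+ 4 \Po 'X^a) * (theta n ^+ 8 \Po 'X^b))`_n =
    8 * dilate a (sigma_nat 1) n - 32 * dilate (4 * a) (sigma_nat 1) n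
    + 16 * dilate b (sigma_nat 3) n - 32 * dilate (2 * b) (sigma_nat 3) n
    + 256 * dilate (4 * b) (sigma_nat 3) n
    + 128 * conv (dilate a (sigma_nat 1)) (dilate b (sigma_nat 3)) n
    - 256 * conv (dilate a (sigma_nat 1)) (dilate (2 * b) (sigma_nat 3)) n
    + 2048 * conv (dilate a (sigma_nat 1)) (dilate (4 * b) (sigma_nat 3)) n
    - 512 * conv (dilate (4 * a) (sigma_nat 1)) (dilate b (sigma_nat 3)) n
    + 1024 * conv (dilate (4 * a) (sigma_nat 1)) (dilate (2 * b) (sigma_nat 3)) n
    - 8192 * conv (dilate (4 * a) (sigma_nat 1)) (dilate (4 * b) (sigma_nat 3)) n.
Proof.
move=> n0 a0 b0; rewrite -conv_expand // coef_comp_Xn_mul //.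
by apply: eq_bigr => j _; rewrite dilate_theta4 ?dilate_theta8 ?leq_subr // -ltnS.
Qed.

Theorem theorem4p1 (n a b a1 b1 : nat)
  (n_gt0 : (0 < n)%N) (a_gt0 : (0 < a)%N) (b_gt0 : (0 < b)%N)
  (a1_gt0 : (0 < a1)%N) (b1_gt0 : (0 < b1)%N)
  (gcd_ab : gcdn a b = 1%N) (gcd_a1b1 : gcdn a1 b1 = 1%N) :
  (Nrep 4 8 a b n)%:Z =
      8 * sigma 1 (n%:R / a%:R) - 32 * sigma 1 (n%:R / (4 * a%:R))
    + 16 * sigma 3 (n%:R / b%:R) - 32 * sigma 3 (n%:R / (2 * b%:R))
    + 256 * sigma 3 (n%:R / (4 * b%:R))
    + 128 * W 1 3 a b n%:R - 256 * W 1 3 a (2 * b) n%:R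
    + 2048 * W 1 3 a (4 * b) n%:R - 512 * W 1 3 (4 * a) b n%:R
    + 1024 * W 1 3 (2 * a) b (n%:R / 2) - 8192 * W 1 3 a b (n%:R / 4)
  /\
  (Nrep 8 4 a1 b1 n)%:Z =
      8 * sigma 1 (n%:R / b1%:R) - 32 * sigma 1 (n%:R / (4 * b1%:R))
    + 16 * sigma 3 (n%:R / a1%:R) - 32 * sigma 3 (n%:R / (2 * a1%:R))
    + 256 * sigma 3 (n%:R / (4 * a1%:R))
    + 128 * W 3 1 a1 b1 n%:R - 512 * W 3 1 a1 (4 * b1) n%:R
    - 256 * W 3 1 (2 * a1) b1 n%:R + 1024 * W 3 1 a1 (2 * b1) (n%:R / 2)
    + 2048 * W 3 1 (4 * a1) b1 n%:R - 8192 * W 3 1 a1 b1 (n%:R / 4).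
Proof.
have two_two c : (2 * (2 * c) = 4 * c)%N by rewrite mulnA.
split; rewrite Nrep_coef // -!natrM !sigma_div ?muln_gt0 //.
  rewrite (W_scale _ _ 2) // (W_scale _ _ 4) // !two_two !W_conv ?muln_gt0 //.
  by rewrite coef_theta4_theta8.
rewrite (W_scale _ _ 2) // (W_scale _ _ 4) // !two_two !W_conv ?muln_gt0 //.
(* The second formula is the first one for (b1, a1), with the two factors of each convolution
   exchanged. *)
rewrite mulrC coef_theta4_theta8 // !(convC _ (dilate _ (sigma_nat 1))).
ring.
Qed.
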